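(* Let $\psi$ be a Young function for which there exist constants $C>0$ and $x_0\ge 0$ such that $x\le C\,\psi(x)$ and $\psi(x)\le C\,e^{x}$ for all $x\ge x_0$. Then there exist constants $c_\psi, C_\psi>0$ depending only on $\psi$ such that for every $N\ge 1$ and all $x_1,\ldots,x_N\in\mathbb{C}$, $$c_\psi\left\|\sum_{n=1}^N x_n r_n\right\|_{L^2}\le \left\|\sum_{n=1}^N x_n r_n\right\|_{L^\psi}\le C_\psi\left\|\sum_{n=1}^N x_n r_n\right\|_{L^2},\qquad \left\|\sum_{n=1}^N x_n r_n\right\|_{L^2}=\left(\sum_{n=1}^N|x_n|^2\right)^{1/2},$$ where $r_n$ is the $n$-th Rademacher function on $[0,1]$ and the norms are taken over $[0,1]$ with Lebesgue measure.
   Context: A Young function (also called Orlicz function) is a convex map $\psi:[0,\infty)\to[0,\infty)$ with $\psi(x)/x\to\infty$ as $x\to\infty$ and $\psi(x)/x\to 0$ as $x\to 0$. For a probability space $(Y,\mu)$ and a measurable function $f:Y\to\mathbb{R}$ or $\mathbb{C}$, the (Luxemburg) norm is $$\|f\|_{L^\psi(Y)}=\inf\left\{\lambda>0:\int_Y\psi\left(\frac{|f|}{\lambda}\right)d\mu\le 1\right\},$$ with value $\infty$ if no such $\lambda$ exists. The Orlicz space $L^\psi(Y)$ consists of the measurable $f$ with $\|f\|_{L^\psi(Y)}<\infty$. The Rademacher functions are $r_n(t)=\operatorname{sign}(\sin(2\pi 2^n t))$, viewed as random variables on $[0,1]$ with Lebesgue measure.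
   Formalization: The Young function is additionally required to satisfy ψ(0)=0; without it a convex ψ may jump at 0, and if ψ(0)>1 the zero sum has infinite L^ψ norm, so the upper bound fails for x_1=…=x_N=0. *)

(* Defs.v *)
From HB Require Import structures.
From mathcomp Require Import all_boot all_order all_algebra.
From mathcomp Require Import all_classical all_reals all_analysis.
From mathcomp.real_closed Require Import complex.
Import Order.TTheory GRing.Theory Num.Theory.
Import numFieldNormedType.Exports.

Set Implicit Arguments.
Unset Strict Implicit.
Unset Printing Implicit Defensive.

Local Open Scope classical_set_scope.
Local Open Scope ring_scope.

(* Only the values of [psi] on [0, +oo[ matter.  The normalization [psi 0 = 0],
   standard for Young functions, cannot be omitted: it does not follow from the
   other clauses, since a convex function may jump upwards at the endpoint 0,
   and if [psi 0 > 1] then the function 0 has infinite Luxemburg norm. *)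
Definition young_function (R : realType) (psi : R -> R) : Prop :=
  [/\ forall x, 0 <= x -> 0 <= psi x,
      psi 0 = 0,
      convex_function (`[0, +oo[%classic : set R) psi,
      psi x / x @[x --> +oo] --> +oo &
      psi x / x @[x --> 0^'+] --> 0].

(* The modulus of a complex number, as an element of [R]; the norm `|z| of the
   library has values in [R[i]]. *)
Definition cmod (R : realType) (z : R[i]) : R := ComplexField.Normc.normc z.

(* The infimum of the empty set is [+oo]. *)
Definition luxemburg_norm d (T : measurableType d) (R : realType)
    (mu : probability T R) (psi : R -> R) (f : T -> R[i]) : \bar R :=
  ereal_inf (EFin @` [set lambda : R |
    0 < lambda /\ (\int[mu]_x (psi (cmod (f x) / lambda))%:E <= 1)%E]).

Definition L2norm d (T : measurableType d) (R : realType)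
    (mu : probability T R) (f : T -> R[i]) : \bar R :=
  'N[mu]_2%:E[(fun x => (cmod (f x))%:E)]%E.

Section lebesgue01.
Context (R : realType).

Definition lebesgue01 : set (measurableTypeR R) -> \bar R :=
  mrestr (@lebesgue_measure R) (measurable_itv `[(0:R), 1]).

HB.instance Definition _ := Measure.on lebesgue01.

Let lebesgue01_setT : lebesgue01 [set: _] = 1%E.
Proof.
by rewrite /lebesgue01 /mrestr setTI/= lebesgue_measure_itv/= lte_fin ltr01 oppr0 adde0.
Qed.

HB.instance Definition _ :=
  @Measure_isProbability.Build _ _ R lebesgue01 lebesgue01_setT.

End lebesgue01.
Arguments lebesgue01 : clear implicits.

Definition rademacher (R : realType) (n : nat) (t : R) : R :=
  Num.sg (sin (2 * pi * 2 ^+ n * t)).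

(* The index [n : 'I_N] stands for [n.+1] in {1, ..., N}. *)
Definition rademacher_sum (R : realType) (N : nat) (x : 'I_N -> R[i]) (t : R) :
    R[i] :=
  \sum_(n < N) x n * (rademacher n.+1 t)%:C%C.

(* Main.v *)
Require Import Defs.
From mathcomp Require Import all_boot all_order all_algebra.
From mathcomp Require Import all_classical all_reals all_analysis.
From mathcomp.real_closed Require Import complex.
From HB Require Import structures.
From mathcomp Require Import measurable_realfun ring lra.
Import Order.TTheory GRing.Theory Num.Theory.
Import numFieldNormedType.Exports.

Local Open Scope classical_set_scope.
Local Open Scope ring_scope.

(* Translating by half a period of r_k flips r_k, fixes every r_j with j > k
   and preserves the integral over [0, 1] of 1-periodic functions.  Averaging
   over this translation peels off one Rademacher function at a time and gives
   both E (sum a_n r_n)^2 = sum a_n^2 and the sub-Gaussian bound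
   E exp(sum a_n r_n) <= exp(2 sum a_n^2).  Hence, for f the Rademacher sum and
   s = ||f||_2, E exp(|f|/s) is bounded by an absolute constant D.
   Upper bound: psi(u) <= B exp(u) for all u >= 0 and psi(u/K) <= psi(u)/K by
   convexity, so E psi(|f|/(K s)) <= 1 for K >= B D.
   Lower bound: u^2 <= K u + 24 exp(u)/K^2 bounds E|f|/s from below, and
   u <= x0 + C psi(u) bounds E|f|/l from above when E psi(|f|/l) <= 1. *)

(** * The complex modulus and elementary properties of Young functions *)

Lemma cmod_ge0 (R : realType) (z : R[i]) : 0 <= cmod z.
Proof. by case: z => a b; exact: sqrtr_ge0. Qed.

Lemma cmod_sqr (R : realType) (z : R[i]) :
  cmod z ^+ 2 = complex.Re z ^+ 2 + complex.Im z ^+ 2.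
Proof. by case: z => a b; rewrite /cmod /= sqr_sqrtr// addr_ge0// sqr_ge0. Qed.

Lemma cmod_le (R : realType) (z : R[i]) :
  cmod z <= `|complex.Re z| + `|complex.Im z|.
Proof.
rewrite -ler_sqr ?nnegrE ?cmod_ge0 ?addr_ge0// cmod_sqr sqrrD !real_normK ?num_real//.
by rewrite [leRHS]addrAC lerDl mulrn_wge0// mulr_ge0.
Qed.

(** Convexity between [x] and the endpoint 0, where [psi] vanishes. This is how enlarging the
    Luxemburg parameter by a factor shrinks the integral by at least that factor. *)
Lemma young_function_star (R : realType) (psi : R -> R) (t x : R) :
  young_function psi -> 0 <= t <= 1 -> 0 <= x -> psi (t * x) <= t * psi x.
Proof.
move=> [_ psi0 cvx _ _] /andP[t0 t1] x0.
have := cvx (Itv01 t0 t1) x 0; rewrite !inE/= !in_itv/= !andbT lexx.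
move=> /(_ x0 isT); rewrite !convRE/= psi0 !mulr0 !addr0.
suff -> : conv (Itv01 t0 t1) (x : convex_lmodType R^o) 0 = t * x by [].
by rewrite [LHS](_ : _ = t * x + (1 - t) * 0)// mulr0 addr0.
Qed.

(** Write [x] as [(x / y) * y], apply the star-shape inequality and drop the factor [x / y <= 1],
    using [psi y >= 0]. *)
Lemma young_function_homo (R : realType) (psi : R -> R) (x y : R) :
  young_function psi -> 0 <= x -> x <= y -> psi x <= psi y.
Proof.
move=> psiY x0 xy; have [psi_ge0 _ _ _ _] := psiY.
have y0 : 0 <= y by exact: le_trans xy.
have [y00|yn0] := eqVneq y 0.
  by have -> : x = y by apply/le_anti; rewrite xy y00 x0.
have yp : 0 < y by rewrite lt_neqAle eq_sym yn0.
have xy01 : 0 <= x / y <= 1 by rewrite divr_ge0//= ler_pdivrMr// mul1r.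
have := young_function_star R psi (x / y) y psiY xy01 y0; rewrite divfK//.
move=> /le_trans; apply; rewrite ler_piMl ?psi_ge0//.
by case/andP: xy01.
Qed.

(** Nothing is known of [psi] on negative reals. Since [u >= 0], [psi] may be replaced by
    [y |-> psi (max 0 y)], which is monotone on the whole line, hence measurable. *)
Lemma measurable_young_comp (R : realType) (psi : R -> R) d
    (T : measurableType d) (u : T -> R) :
  young_function psi -> measurable_fun setT u -> (forall x, 0 <= u x) ->
  measurable_fun setT (fun x => psi (u x)).
Proof.
move=> psiY mu u0.
have -> : (fun x => psi (u x)) = (fun y => psi (Num.max 0 y)) \o u.
  by apply/funext => x /=; rewrite max_r.
apply: measurableT_comp => //; apply: nondecreasing_measurable => // x y xy.
apply: young_function_homo => //; first by rewrite le_max lexx.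
by rewrite ge_max !le_max lexx/= xy orbT.
Qed.

(** Removes the threshold: for [u < x0], monotonicity gives [psi u <= psi x0 <= C * expR x0], and
    [expR u >= 1]. *)
Lemma young_function_le_expR (R : realType) (psi : R -> R) (C x0 u : R) :
  young_function psi -> 0 < C -> 0 <= x0 ->
  (forall x, x0 <= x -> psi x <= C * expR x) ->
  0 <= u -> psi u <= C * expR x0 * expR u.
Proof.
move=> psiY C0 x00 psiC u0.
have e0 : 1 <= expR x0 by rewrite -expR0 ler_expR.
have eu : 1 <= expR u by rewrite -expR0 ler_expR.
have [ux|ux] := leP x0 u.
  apply: (le_trans (psiC _ ux)); rewrite -mulrA ler_pM2l// ler_peMl//.
apply: (le_trans (young_function_homo _ _ _ _ psiY u0 (ltW ux))).
apply: (le_trans (psiC _ (lexx _))).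
by rewrite ler_peMr// mulr_ge0// ?expR_ge0// ltW.
Qed.

(** For [u <= K] the linear term suffices. For [u > K], [u ^+ 2 <= u ^+ 4 / K ^+ 2], and the degree
    4 term of the exponential series gives [u ^+ 4 <= 24 * expR u]. *)
Lemma sqr_le_lin_expR (R : realType) (K u : R) :
  0 < K -> 0 <= u -> u ^+ 2 <= K * u + 24 / K ^+ 2 * expR u.
Proof.
move=> K0 u0; have e := expR_ge1Dxn 3 u0.
have {}e : u ^+ 4 <= 24 * expR u.
  by move: e; rewrite (_ : (4`!)%:R = 24 :> R)//; lra.
have K2 : 0 < K ^+ 2 by rewrite exprn_gt0.
have [uK|uK] := leP u K.
  apply: (@le_trans _ _ (K * u)); first by rewrite expr2 ler_wpM2r.
  by rewrite lerDl mulr_ge0 ?expR_ge0// divr_ge0// ltW.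
apply: (@le_trans _ _ (24 / K ^+ 2 * expR u)); last by rewrite lerDr mulr_ge0// ltW.
rewrite mulrAC ler_pdivlMr//; apply: le_trans e.
rewrite (_ : u ^+ 4 = u ^+ 2 * u ^+ 2); last by rewrite -exprD.
by rewrite ler_wpM2l ?sqr_ge0// lerXn2r// ?nnegrE ltW.
Qed.

(** * Luxemburg norm bounds from exponential and second moments *)

Section luxemburg_bounds.
Context d (T : measurableType d) (R : realType) (P : probability T R).
Variables (psi : R -> R) (C x0 : R).
Hypothesis psiY : young_function psi.
Hypotheses (C0 : 0 < C) (x00 : 0 <= x0).

(** The scale [s] need not be the L2 norm: any positive scale with a bounded exponential moment will
    do, which later covers the case of a zero sum. *)
Lemma luxemburg_norm_le_exp_moment (f : T -> R[i]) (s D : R) :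
  (forall x, x0 <= x -> psi x <= C * expR x) ->
  measurable_fun setT (fun x => cmod (f x)) -> 0 < s -> 0 < D ->
  (\int[P]_x (expR (cmod (f x) / s))%:E <= D%:E)%E ->
  (luxemburg_norm P psi f <= ((1 + C * expR x0 * D) * s)%:E)%E.
Proof.
move=> psiC mf s0 D0 fD; set B := C * expR x0.
have B0 : 0 < B by rewrite mulr_gt0// expR_gt0.
(* [K >= 1] allows [K^-1] to be pulled out of [psi], and [K >= B * D] brings the resulting bound
   [K^-1 * B * D] below 1. *)
set K := 1 + B * D; have BD0 : 0 < B * D by rewrite mulr_gt0.
have K0 : 0 < K by rewrite /K; lra.
have cf x : 0 <= cmod (f x) by exact: cmod_ge0.
have fs0 x : 0 <= cmod (f x) / s by rewrite divr_ge0// ltW.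
have mfs : measurable_fun setT (fun x => cmod (f x) / s) by exact: measurable_funM.
apply: ereal_inf_lbound => /=; exists (K * s) => //; split; first by rewrite mulr_gt0.
have [psi_ge0 _ _ _ _] := psiY.
apply: (@le_trans _ _ (\int[P]_x ((K^-1 * B)%:E * (expR (cmod (f x) / s))%:E))%E).
  apply: ge0_le_integral => //.
  - by move=> x _; rewrite lee_fin psi_ge0// divr_ge0// mulr_ge0// ltW.
  - apply/measurable_EFinP; apply: measurable_young_comp => //.
      exact: measurable_funM.
    by move=> x; rewrite divr_ge0// mulr_ge0// ltW.
  - apply: measurable_funeM; apply/measurable_EFinP; exact: measurableT_comp.
  - move=> x _; rewrite -EFinM lee_fin.
    have -> : cmod (f x) / (K * s) = K^-1 * (cmod (f x) / s).
      by rewrite invfM mulrCA.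
    have K1 : 0 <= K^-1 <= 1.
      by rewrite invr_ge0 ltW//= invf_le1// /K; lra.
    apply: (le_trans (young_function_star _ _ _ _ psiY K1 (fs0 x))).
    by rewrite -mulrA ler_pM2l ?invr_gt0//; exact: young_function_le_expR.
rewrite ge0_integralZl_EFin//; last 2 first.
- by apply/measurable_EFinP; exact: measurableT_comp.
- by rewrite mulr_ge0 ?invr_ge0// ltW.
apply: (@le_trans _ _ ((K^-1 * B)%:E * D%:E)%E).
  by rewrite lee_pmul2l// lte_fin mulr_gt0// invr_gt0.
by rewrite -EFinM lee_fin -mulrA ler_pdivrMl// mulr1 /K; lra.
Qed.

Lemma luxemburg_norm_ge_second_moment (f : T -> R[i]) (s D : R) :
  (forall x, x0 <= x -> x <= C * psi x) ->
  measurable_fun setT (fun x => cmod (f x)) -> 0 < s -> 0 < D ->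
  (\int[P]_x (expR (cmod (f x) / s))%:E <= D%:E)%E ->
  (\int[P]_x ((cmod (f x) / s) ^+ 2)%:E = 1)%E ->
  ((s / (2 * (1 + 48 * D) * (x0 + C)))%:E <= luxemburg_norm P psi f)%E.
Proof.
move=> psiC mf s0 D0 fD f2; have [psi_ge0 _ _ _ _] := psiY.
have cf x : 0 <= cmod (f x) by exact: cmod_ge0.
have fs0 x : 0 <= cmod (f x) / s by rewrite divr_ge0// ltW.
have mfs : measurable_fun setT (fun x => cmod (f x) / s) by exact: measurable_funM.
(* Chosen so that [K ^+ 2 >= K >= 48 * D]: the exponential term [24 / K ^+ 2 * D] is then at most
   1/2, half of the second moment. *)
set K := 1 + 48 * D; have K0 : 0 < K by rewrite /K; lra.
have K2 : 0 < K ^+ 2 by rewrite exprn_gt0.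
pose I := (\int[P]_x (cmod (f x) / s)%:E)%E.
have I0 : (0 <= I)%E by apply: integral_ge0 => x _; rewrite lee_fin.
have hI : (1 <= K%:E * I + (2^-1)%:E)%E.
  rewrite -f2; apply: (@le_trans _ _ (\int[P]_x
    (K%:E * (cmod (f x) / s)%:E
     + (24 / K ^+ 2)%:E * (expR (cmod (f x) / s))%:E))%E).
    apply: ge0_le_integral => //.
    - by move=> x _; rewrite lee_fin sqr_ge0.
    - by apply/measurable_EFinP; exact: measurable_funX.
    - apply: emeasurable_funD; apply: measurable_funeM; apply/measurable_EFinP => //.
      exact: measurableT_comp.
    - by move=> x _; rewrite -!EFinM -EFinD lee_fin sqr_le_lin_expR.
  have mexp : measurable_fun setT (fun x => expR (cmod (f x) / s)).
    exact: measurableT_comp.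
  rewrite ge0_integralD//; last 4 first.
  - by move=> x _; rewrite -EFinM lee_fin mulr_ge0// ltW.
  - by apply: measurable_funeM; exact/measurable_EFinP.
  - by move=> x _; rewrite -EFinM lee_fin mulr_ge0 ?expR_ge0// divr_ge0// ltW.
  - by apply: measurable_funeM; exact/measurable_EFinP.
  rewrite !ge0_integralZl_EFin//; try by [exact/measurable_EFinP
    |move=> x _; rewrite lee_fin ?expR_ge0|rewrite ?divr_ge0// ltW].
  apply: leeD => //; apply: (@le_trans _ _ ((24 / K ^+ 2)%:E * D%:E)%E).
    by rewrite lee_pmul2l// lte_fin divr_gt0.
  rewrite -EFinM lee_fin mulrAC ler_pdivrMr// /K; nra.
(* It suffices to bound each admissible parameter [l] from below. *)
apply: le_ereal_inf_tmp => _ /= [l [l0 hl] <-]; rewrite lee_fin.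
have fl0 x : 0 <= cmod (f x) / l by rewrite divr_ge0// ltW.
(* Integrate [u <= x0 + C * psi u] at [u = cmod (f x) / l]; the total mass is 1 and the integral of
   [psi u] is at most 1. *)
have hI2 : ((s / l)%:E * I <= (x0 + C)%:E)%E.
  rewrite -ge0_integralZl_EFin//; last 3 first.
  - by move=> x _; rewrite lee_fin.
  - exact/measurable_EFinP.
  - by rewrite divr_ge0// ltW.
  have mpsi : measurable_fun setT (fun x => psi (cmod (f x) / l)).
    by apply: measurable_young_comp => //; exact: measurable_funM.
  apply: (@le_trans _ _ (\int[P]_x (x0%:E + C%:E * (psi (cmod (f x) / l))%:E))%E).
    apply: ge0_le_integral => //.
    - by move=> x _; rewrite -EFinM lee_fin mulr_ge0// divr_ge0// ltW.
    - by apply: measurable_funeM; exact/measurable_EFinP.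
    - apply: emeasurable_funD => //; apply: measurable_funeM; exact/measurable_EFinP.
    - move=> x _; rewrite -!EFinM -EFinD lee_fin.
      have -> : s / l * (cmod (f x) / s) = cmod (f x) / l.
        by field; rewrite !gt_eqF.
      have [h|h] := leP x0 (cmod (f x) / l).
        by apply: (le_trans (psiC _ h)); rewrite lerDr.
      by rewrite ler_wpDr ?(ltW h)// mulr_ge0 ?(ltW C0)// psi_ge0.
  rewrite ge0_integralD//; last 2 first.
  - by move=> x _; rewrite -EFinM lee_fin mulr_ge0 ?(ltW C0)// psi_ge0.
  - by apply: measurable_funeM; exact/measurable_EFinP.
  rewrite integral_cst// [X in (_ * X)%E](probability_setT P) mule1 EFinD leeD2lE//.
  rewrite ge0_integralZl_EFin//; last 3 first.
  - by move=> x _; rewrite lee_fin psi_ge0.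
  - exact/measurable_EFinP.
  - exact: ltW.
  by rewrite -[leRHS]mule1 lee_pmul2l// lte_fin.
have xC0 : 0 < x0 + C by rewrite ltr_wpDl.
have sl0 : 0 < s / l by rewrite divr_gt0.
(* An infinite first moment would contradict [hI2]; from here on the argument is real arithmetic,
   with [1 / (2 * K) <= J <= (x0 + C) * l / s]. *)
have If : I \is a fin_num.
  rewrite ge0_fin_numE// ltNge leye_eq; apply/negP => /eqP Iy.
  by move: hI2; rewrite Iy gt0_muley ?lte_fin// leye_eq.
move: hI hI2; rewrite -(fineK If) -!EFinM -EFinD !lee_fin.
set J := fine I => h1 h2.
rewrite ler_pdivrMr ?mulr_gt0//.
have h3 : s * J <= l * (x0 + C).
  have -> : s * J = l * (s / l * J) by field; rewrite gt_eqF.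
  by rewrite ler_pM2l.
have h4 : s <= 2 * K * (s * J).
  have h5 : 1 <= 2 * K * J by lra.
  have -> : 2 * K * (s * J) = s * (2 * K * J) by ring.
  by rewrite ler_peMr// ltW.
apply: (le_trans h4).
have -> : l * (2 * K * (x0 + C)) = 2 * K * (l * (x0 + C)) by ring.
by rewrite ler_pM2l// mulr_gt0.
Qed.

End luxemburg_bounds.

(** * Translation invariance of integrals of 1-periodic functions over [0, 1] *)

Lemma lebesgue_measure_translation (R : realType) (h : R)
    (A : set (measurableTypeR R)) : measurable A ->
  lebesgue_measure ((fun t : measurableTypeR R => t + h) @^-1` A) =
  lebesgue_measure A.
Proof.
have mh : measurable_fun [set: measurableTypeR R]
    ((fun t => t + h) : measurableTypeR R -> measurableTypeR R).
  exact: measurable_funD.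
pose H := isMeasurableFun.Build _ _ _ _ _ mh.
pose sh : {mfun measurableTypeR R >-> measurableTypeR R} := HB.pack
  ((fun t => t + h) : measurableTypeR R -> measurableTypeR R) H.
move=> mA; apply/esym.
(* Lebesgue measure is determined by its values on half-open intervals, so it is enough to compare
   it there with its pushforward under the translation. *)
apply: (@lebesgue_measure_unique R (pushforward lebesgue_measure sh)) => //.
move=> _ [[a b]] _ <- /=; rewrite /pushforward.
have -> : sh @^-1` `]a, b] = `]a - h, b - h]%classic.
  by apply/seteqP; split => t /=; rewrite !in_itv/= ltrBlDr lerBrDr.
rewrite !lebesgue_measure_itv/= !lte_fin ltrD2r.
by case: ifP => // _; rewrite -!EFinD; congr EFin; ring.
Qed.

(** The point 1 is a null set. Dropping it makes the interval a fundamental domain for translation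
    modulo 1. *)
Lemma lebesgue01E (R : realType) (A : set (measurableTypeR R)) : measurable A ->
  lebesgue01 R A = lebesgue_measure (A `&` `[0, 1[).
Proof.
move=> mA; rewrite /lebesgue01/= /mrestr.
have -> : A `&` `[0, 1] = (A `&` `[0, 1[) `|` (A `&` [set 1]).
  by rewrite -setIUr setUitv1//= bnd_simp ler01.
rewrite measureU0 //.
- by apply: measurableI => //; exact: measurable_itv.
- by apply: measurableI => //; exact: measurable_set1.
apply/eqP; rewrite eq_le measure_ge0 andbT -(lebesgue_measure_set1 (1 : R)).
apply: le_measure; rewrite ?inE//.
exact: measurableI.
Qed.

Lemma integral_lebesgue01_translation (R : realType) (h : R)
    (f : measurableTypeR R -> R) :
  0 <= h <= 1 -> measurable_fun setT f -> (forall t, 0 <= f t) ->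
  periodic f 1 ->
  (\int[lebesgue01 R]_t (f (t + h))%:E = \int[lebesgue01 R]_t (f t)%:E)%E.
Proof.
move=> /andP[h0 h1] mf f0 fp.
(* Translation by [h] modulo 1 on [0, 1[. By periodicity [f (t + h) = f (T t)], so the claim reduces
   to invariance of the measure under [T]. *)
pose T (t : measurableTypeR R) : measurableTypeR R :=
  if t < 1 - h then t + h else t + (h - 1).
have mT : measurable_fun setT T.
  apply: measurable_fun_ifT => //=; first exact: measurable_fun_ltr.
    exact: measurable_funD.
  exact: measurable_funD.
have fT t : f (t + h) = f (T t).
  rewrite /T; case: ifP => // _.
  by rewrite -(fp (t + (h - 1))); congr f; ring.
pose H := isMeasurableFun.Build _ _ _ _ _ mT.
pose T' : {mfun measurableTypeR R >-> measurableTypeR R} := HB.pack T H.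
under eq_integral do rewrite fT.
transitivity (\int[pushforward (lebesgue01 R) T']_t (f t)%:E)%E.
  rewrite (@ge0_integral_pushforward _ _ _ _ R T' mT)//.
  by apply/measurable_EFinP.
  by move=> t _; rewrite lee_fin.
apply: eq_measure_integral => A mA _; rewrite /= /pushforward.
have mTA : measurable (T @^-1` A) by rewrite -[X in measurable X]setTI; exact: (mT measurableT _ mA).
rewrite !lebesgue01E//.
have mD (a b : bool) c d e : measurable
   ((fun t : measurableTypeR R => t + e) @^-1`
     (A `&` [set` Interval (BSide a c) (BSide b d)])).
  rewrite -[X in measurable X]setTI.
  have : measurable_fun setT (fun t : measurableTypeR R => t + e :> measurableTypeR R).
    exact: measurable_funD.
  by apply => //; apply: measurableI => //; exact: measurable_itv.
have mI (a b : bool) (c d : R) : measurable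
   (A `&` [set` Interval (BSide a c) (BSide b d)]).
  by apply: measurableI => //; exact: measurable_itv.
(* Cut [0, 1[ at [1 - h]: the left piece is translated onto [h, 1[, the right piece onto [0, h[.
   Each translation preserves Lebesgue measure. *)
have -> : T @^-1` A `&` `[0, 1[ =
  (fun t => t + h) @^-1` (A `&` `[h, 1[) `|`
  (fun t => t + (h - 1)) @^-1` (A `&` `[0, h[).
  apply/seteqP; split => t /=; rewrite /T !in_itv/=.
    case: (ltP t (1 - h)) => th [At /andP[t0 t1]]; [left|right]; split => //;
    apply/andP; split; lra.
  move=> [] [At /andP[t0 t1]].
    by split; [case: (ltP t (1 - h)) => th //; lra|apply/andP; split; lra].
  by split; [case: (ltP t (1 - h)) => th //; lra|apply/andP; split; lra].
rewrite measureU//; last first.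
  apply/seteqP; split => t //=; rewrite !in_itv/= => -[[_ /andP[? ?]] [_ /andP[? ?]]].
  lra.
transitivity (lebesgue_measure (A `&` `[h, 1%R[) +
              lebesgue_measure (A `&` `[0%R, h[))%E.
  by congr (_ + _)%E; apply: lebesgue_measure_translation.
rewrite addeC -measureU//; last first.
  apply/seteqP; split => t //=; rewrite !in_itv/= => -[[_ /andP[? ?]] [_ /andP[? ?]]].
  lra.
congr lebesgue_measure; rewrite -setIUr; congr (_ `&` _).
apply/seteqP; split => t /=; rewrite !in_itv/=.
  by move=> [] /andP[? ?]; apply/andP; split; lra.
by move=> /andP[? ?]; case: (ltP t h) => th; [left|right]; apply/andP.
Qed.

(** * Symmetries and second moment of single Rademacher functions *)

Lemma rademacher_norm_le1 (R : realType) k (t : R) : `|rademacher k t| <= 1.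
Proof. by rewrite normr_sg; case: (_ != 0). Qed.

Lemma measurable_rademacher (R : realType) k :
  measurable_fun setT (rademacher k : measurableTypeR R -> R).
Proof.
apply: (@measurableT_comp _ _ _ _ _ _ (@Num.sg R)).
  apply: nondecreasing_measurable => // x y xy.
  have [x0|x0|x0] := ltgtP x 0; have [y0|y0|y0] := ltgtP y 0;
    rewrite ?(ltr0_sg x0) ?(gtr0_sg x0) ?(ltr0_sg y0) ?(gtr0_sg y0) ?x0 ?y0 ?sgr0 //;
    lra.
apply: (@measurableT_comp _ _ _ _ _ _ (@sin R) setT
  (fun t => 2 * pi * 2 ^+ k * t)).
  by apply: continuous_measurable_fun; exact: continuous_sin.
exact: measurable_funM.
Qed.

(** The shift is half a period of the function of index [k]. It adds [2 ^ m * pi] to the argument of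
    the sine: a sign change for [m = 0], a multiple of [2 * pi] for [m > 0]. *)
Lemma rademacher_shift (R : realType) k m (t : R) :
  rademacher (k + m) (t + (2 ^+ k.+1)^-1) =
  (if m == 0%N then - rademacher k t else rademacher (k + m) t).
Proof.
rewrite /rademacher; have k0 : (2 : R) ^+ k != 0 by rewrite expf_neq0.
case: m => [|m] /=.
  rewrite addn0 -sgrN -sinDpi; congr (Num.sg (sin _)).
  by rewrite exprS; field.
rewrite -[in RHS](periodicn (@sinD2pi R) (2 ^ m)%N); congr (Num.sg (sin _)).
rewrite -(mulr_natr _ (2 ^ m)%N) -(mulr_natr pi 2) natrX exprD !exprS.
by field.
Qed.

Lemma rademacher_periodic (R : realType) k : periodic (@rademacher R k) 1.
Proof.
move=> t; rewrite /rademacher -[in RHS](periodicn (@sinD2pi R) (2 ^ k)%N).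
congr (Num.sg (sin _)).
by rewrite -(mulr_natr _ (2 ^ k)%N) -(mulr_natr pi 2) natrX; ring.
Qed.

(** Subtract the integer part of [x / pi] times [pi]: the remainder lies in [0, pi[ and is still a
    zero of the sine, which is positive inside that interval. *)
Lemma sin_eq0_natmul_pi (R : realType) (x : R) :
  0 <= x -> sin x = 0 -> exists n : nat, x = pi *+ n.
Proof.
move=> x0 sx; have pi0 := pi_gt0 R; exists (Num.truncn (x / pi)).
set n := Num.truncn _.
have /truncn_itv/andP[n1 n2] : 0 <= x / pi by rewrite divr_ge0// ltW.
rewrite -/n ler_pdivlMr// in n1; rewrite -/n ltr_pdivrMr// in n2.
apply/eqP; rewrite -subr_eq0; apply/negPn/negP => xn.
have : sin (x - pi *+ n) = 0.
  have := alternatingn (@sinDpi R) n (x - pi *+ n).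
  by rewrite subrK sx => /esym/eqP; rewrite mulf_eq0 signr_eq0 => /eqP.
apply/eqP; rewrite gt_eqF// sin_gt0_pi// -mulr_natl.
rewrite -natr1 mulrDl mul1r in n2.
rewrite lt_neqAle eq_sym mulr_natl xn /= subr_ge0 -mulr_natl n1/=.
lra.
Qed.

(** The square equals 1 except where the sine vanishes, and these zeros form a countable set. *)
Lemma integral_rademacher_sqr (R : realType) k :
  (\int[lebesgue01 R]_t (rademacher k t ^+ 2)%:E = 1)%E.
Proof.
transitivity (\int[lebesgue01 R]_t (1%:E : \bar R))%E; last first.
  by rewrite integral_cst// mul1e; exact: (probability_setT (lebesgue01 R)).
apply: ae_eq_integral => //.
- apply/measurable_EFinP; apply: measurable_funX.
  exact: measurable_rademacher.
(* The nonnegative dyadic points [n / 2 ^+ k.+1] contain all zeros in [0, 1]. The complement of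
   [0, 1] joins the exceptional set, being null for the restricted measure. *)
pose Z : set (measurableTypeR R) := range (fun n : nat => n%:R / 2 ^+ k.+1).
have cZ : countable Z by exact: card_image_le.
exists (Z `|` ~` `[0, 1]); split.
- apply: measurableU.
    exact: countable_measurable.
  by apply: measurableC; exact: measurable_itv.
- transitivity (lebesgue_measure (Z `&` `[0, 1])).
    by congr lebesgue_measure; rewrite setIUl setICl setU0.
  apply/eqP; rewrite eq_le measure_ge0 andbT -(countable_lebesgue_measure0 cZ).
  apply: le_measure; rewrite ?inE.
  + apply: measurableI; last exact: measurable_itv.
    exact: countable_measurable.
  + exact: countable_measurable.
  + exact: subIsetl.
- move=> t /= /not_implyP[_ rt].
  case: (pselect (`[0, 1]%classic t)) => [|]; last by right.
  rewrite /= in_itv/= => /andP[t0 t1]; left.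
  have [s0|s0] := eqVneq (sin (2 * pi * 2 ^+ k * t)) 0; last first.
    by exfalso; apply: rt; rewrite /rademacher sqr_sg s0.
  have [|n hn] := sin_eq0_natmul_pi _ _ _ s0.
    by rewrite !mulr_ge0// ?exprn_ge0// pi_ge0.
  exists n => //.
  have := pi_gt0 R => p0; have k0 : (2 : R) ^+ k != 0 by rewrite expf_neq0.
  have pn : pi != 0 :> R by rewrite gt_eqF.
  apply: (mulfI (mulf_neq0 pn (mulf_neq0 (_ : 2 != 0) k0))) => //.
  rewrite exprS mulrA [LHS](_ : _ = pi * n%:R); last by field.
  by rewrite mulr_natr -hn; ring.
Qed.

(** * Second and exponential moments of real Rademacher combinations *)

Definition rademacher_comb (R : realType) (k N : nat) (a : 'I_N -> R)
    (t : R) : R :=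
  \sum_(n < N) a n * rademacher (k + n) t.
Arguments rademacher_comb {R} k {N} a t.

(** Isolates the lowest index; the offset [k] lets an induction on [N] continue with the remaining
    terms at offset [k.+1]. *)
Lemma rademacher_comb_recl (R : realType) k N (a : 'I_N.+1 -> R) (t : R) :
  rademacher_comb k a t =
  a ord0 * rademacher k t
  + rademacher_comb k.+1 (fun i => a (lift ord0 i)) t.
Proof.
rewrite /rademacher_comb big_ord_recl/= addn0; congr (_ + _).
by apply: eq_bigr => i _; rewrite /bump add1n addSnnS.
Qed.

Lemma rademacher_combS_shift (R : realType) k N (a : 'I_N -> R) (t : R) :
  rademacher_comb k.+1 a (t + (2 ^+ k.+1)^-1) = rademacher_comb k.+1 a t.
Proof. by apply: eq_bigr => i _; rewrite addSnnS rademacher_shift. Qed.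

Lemma rademacher_comb_periodic (R : realType) k N (a : 'I_N -> R) :
  periodic (rademacher_comb k a) 1.
Proof. by move=> t; apply: eq_bigr => i _; rewrite rademacher_periodic. Qed.

Lemma measurable_rademacher_comb (R : realType) k N (a : 'I_N -> R) :
  measurable_fun setT (rademacher_comb k a : measurableTypeR R -> R).
Proof.
apply: measurable_sum => i; apply: measurable_funM => //.
exact: measurable_rademacher.
Qed.

(** With [h] half a period of the lowest Rademacher function, the right-hand integrand contains that
    function with both signs and the others unchanged. *)
Lemma integral_lebesgue01_symmetrize (R : realType) (h : R)
    (f : measurableTypeR R -> R) :
  0 <= h <= 1 -> measurable_fun setT f -> (forall t, 0 <= f t) ->
  periodic f 1 ->
  (2%:E * \int[lebesgue01 R]_t (f t)%:E =
   \int[lebesgue01 R]_t (f t + f (t + h)%R)%:E)%E.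
Proof.
move=> h01 mf f0 fp.
have mfh : measurable_fun setT (fun t : measurableTypeR R => f (t + h)).
  apply: (@measurableT_comp _ _ _ _ _ _ f setT
    (fun t : measurableTypeR R => t + h : measurableTypeR R)) => //.
  exact: measurable_funD.
under [RHS]eq_integral do rewrite EFinD.
rewrite ge0_integralD//; [|by move=> *; rewrite lee_fin|exact/measurable_EFinP
  |by move=> *; rewrite lee_fin|exact/measurable_EFinP].
by rewrite integral_lebesgue01_translation// -mule2n -mule_natl.
Qed.

Lemma half_period_itv (R : realType) k : 0 <= (2 ^+ k.+1 : R)^-1 <= 1.
Proof. by rewrite invr_ge0 exprn_ge0//= invf_le1 ?exprn_gt0// exprn_ege1// ler1n. Qed.

(** If [2 * y ^+ 2 > 1], then [|y| <= 2 * y ^+ 2] bounds each exponential. Otherwise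
    [expR (- y) >= 1 - y] and its mirror image give [(p + q) * (1 - y ^+ 2) <= 2], while
    [(1 + 2 * y ^+ 2) * (1 - y ^+ 2) >= 1]. *)
Lemma expRD_expRN_le (R : realType) (y : R) :
  expR y + expR (- y) <= 2 * expR (2 * y ^+ 2).
Proof.
have [y2|y2] := leP (2 * y ^+ 2) 1; last first.
  have h : `|y| <= 2 * y ^+ 2.
    have -> : y ^+ 2 = `|y| ^+ 2 by rewrite real_normK// num_real.
    have : 2 * `|y| ^+ 2 > 1 by rewrite real_normK// num_real.
    by have := normr_ge0 y; nra.
  have e1 : expR y <= expR (2 * y ^+ 2).
    by rewrite ler_expR (le_trans _ h)// ler_norm.
  have e2 : expR (- y) <= expR (2 * y ^+ 2).
    by rewrite ler_expR (le_trans _ h)// -normrN ler_norm.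
  lra.
have e0 : 1 + 2 * y ^+ 2 <= expR (2 * y ^+ 2) by exact: expR_ge1Dx.
have e1 : 1 + y <= expR y by exact: expR_ge1Dx.
have e2 : 1 - y <= expR (- y) by exact: expR_ge1Dx.
have p1 : 0 < expR y by exact: expR_gt0.
have p2 : 0 < expR (- y) by exact: expR_gt0.
have e12 : expR y * expR (- y) = 1 by exact: expRxMexpNx_1.
have l1 : expR y * (1 - y) <= 1 by rewrite -[leRHS]e12 ler_pM2l.
have l2 : expR (- y) * (1 + y) <= 1 by rewrite -[leRHS]e12 [leRHS]mulrC ler_pM2l.
set p := expR y in l1 e12 p1 *; set q := expR (- y) in l2 e12 p2 *.
have m1 : p * (1 - y ^+ 2) <= 1 + y.
  have -> : p * (1 - y ^+ 2) = p * (1 - y) * (1 + y) by ring.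
  by rewrite ler_piMl//; nra.
have m2 : q * (1 - y ^+ 2) <= 1 - y.
  have -> : q * (1 - y ^+ 2) = q * (1 + y) * (1 - y) by ring.
  by rewrite ler_piMl//; nra.
have m : (p + q) * (1 - y ^+ 2) <= 2 by lra.
have y0 := sqr_ge0 y.
apply: (@le_trans _ _ (2 * (1 + 2 * y ^+ 2))); last by rewrite ler_pM2l.
rewrite -(@ler_pM2r _ (1 - y ^+ 2)); last lra.
apply: (le_trans m); nra.
Qed.

(** Induction on [N]: after symmetrization the lowest term contributes [expR y + expR (- y)] as a
    factor, bounded by a constant, and the other factor has offset [k.+1]. *)
Lemma integral_expR_rademacher_comb (R : realType) k N (a : 'I_N -> R) :
  (\int[lebesgue01 R]_t (expR (rademacher_comb k a t))%:E
   <= (expR (2 * \sum_(n < N) a n ^+ 2))%:E)%E.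
Proof.
elim: N k a => [|N IH] k a.
  under eq_integral do rewrite /rademacher_comb big_ord0.
  rewrite big_ord0 mulr0 integral_cst//.
  by rewrite [X in (_ * X)%E](probability_setT (lebesgue01 R)) mule1.
set b := fun i => a (lift ord0 i).
have mE l M (c : 'I_M -> R) : measurable_fun setT
    (fun t : measurableTypeR R => expR (rademacher_comb l c t)).
  by apply: measurableT_comp => //; exact: measurable_rademacher_comb.
rewrite -(@lee_pmul2l _ 2%:E)//.
rewrite (integral_lebesgue01_symmetrize _ _ _ (half_period_itv R k))//; last first.
  by move=> t; rewrite rademacher_comb_periodic.
apply: (@le_trans _ _ (\int[lebesgue01 R]_t
   ((2 * expR (2 * a ord0 ^+ 2))%:E * (expR (rademacher_comb k.+1 b t))%:E))%E).
  apply: ge0_le_integral => //.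
  - apply/measurable_EFinP/measurable_funD => //.
    apply: (@measurableT_comp _ _ _ _ _ _
      (fun t : measurableTypeR R => expR (rademacher_comb k a t)) setT
      (fun t : measurableTypeR R => t + (2 ^+ k.+1)^-1 : measurableTypeR R)) => //.
    exact: measurable_funD.
  - apply: measurable_funeM; exact/measurable_EFinP.
  - move=> t _; rewrite -EFinM lee_fin !rademacher_comb_recl -/b.
    rewrite rademacher_combS_shift -[X in rademacher X (t + _)](addn0 k).
    rewrite rademacher_shift/= mulrN !expRD -mulrDl ler_pM2r ?expR_gt0//.
    apply: (le_trans (expRD_expRN_le _ _)); rewrite ler_pM2l// ler_expR ler_pM2l//.
    (* Only [|r_k| <= 1] is used, so the points where [r_k] vanishes are harmless here. *)
    by rewrite exprMn ler_piMr ?sqr_ge0// -real_normK ?num_real// exprn_ile1 ?rademacher_norm_le1.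
rewrite ge0_integralZl_EFin//; last exact/measurable_EFinP.
rewrite big_ord_recl mulrDr expRD -EFinM (mulrA _ (expR _)) [leRHS]EFinM.
by rewrite lee_pmul2l// ?lte_fin ?mulr_gt0 ?expR_gt0//.
Qed.

(** Same induction; symmetrization cancels the cross term, since
    [(u + v)^2 + (- u + v)^2 = 2 u^2 + 2 v^2]. *)
Lemma integral_rademacher_comb_sqr (R : realType) k N (a : 'I_N -> R) :
  (\int[lebesgue01 R]_t (rademacher_comb k a t ^+ 2)%:E
   = (\sum_(n < N) a n ^+ 2)%:E)%E.
Proof.
elim: N k a => [|N IH] k a.
  under eq_integral do rewrite /rademacher_comb big_ord0 expr0n.
  by rewrite big_ord0 integral0.
set b := fun i => a (lift ord0 i).
have mE l M (c : 'I_M -> R) : measurable_fun setT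
    (fun t : measurableTypeR R => rademacher_comb l c t ^+ 2).
  by apply: measurable_funX; exact: measurable_rademacher_comb.
have mr : measurable_fun setT (fun t : measurableTypeR R => rademacher k t ^+ 2).
  by apply: measurable_funX; exact: measurable_rademacher.
have mul2I (x y : \bar R) : (2%:E * x = 2%:E * y)%E -> x = y.
  by move=> e; apply/le_anti/andP; split; rewrite -(@lee_pmul2l _ 2%:E)// e.
apply: mul2I.
rewrite (integral_lebesgue01_symmetrize _ _ _ (half_period_itv R k))//; last 2 first.
- by move=> t; exact: sqr_ge0.
- by move=> t; rewrite rademacher_comb_periodic.
transitivity (\int[lebesgue01 R]_t ((2 * a ord0 ^+ 2)%:E * (rademacher k t ^+ 2)%:E
   + 2%:E * (rademacher_comb k.+1 b t ^+ 2)%:E)%E)%E.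
  apply: eq_integral => t _; rewrite -!EFinM -EFinD; congr EFin.
  rewrite !rademacher_comb_recl -/b rademacher_combS_shift.
  rewrite -[X in rademacher X (t + _)](addn0 k) rademacher_shift/=; ring.
rewrite ge0_integralD//; last 4 first.
- by move=> t _; rewrite -EFinM lee_fin mulr_ge0 ?sqr_ge0// mulr_ge0 ?sqr_ge0.
- by apply: measurable_funeM; exact/measurable_EFinP.
- by move=> t _; rewrite -EFinM lee_fin mulr_ge0 ?sqr_ge0.
- by apply: measurable_funeM; exact/measurable_EFinP.
rewrite !ge0_integralZl_EFin//;
  try by [exact/measurable_EFinP|move=> t _; rewrite lee_fin sqr_ge0].
- by rewrite integral_rademacher_sqr IH mule1 -!EFinM -EFinD big_ord_recl mulrDr.
- by rewrite mulr_ge0// sqr_ge0.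
Qed.

(** * Complex Rademacher sums through their real and imaginary parts *)

Lemma rademacher_sumE (R : realType) N (x : 'I_N -> R[i]) (t : R) :
  rademacher_sum x t =
  (rademacher_comb 1 (fun n => complex.Re (x n)) t +i*
   rademacher_comb 1 (fun n => complex.Im (x n)) t)%C.
Proof.
apply/eqP; rewrite eq_complex /= /rademacher_sum /rademacher_comb.
apply/andP; split; apply/eqP; rewrite raddf_sum; apply: eq_bigr => n _.
  by case: (x n) => a b /=; rewrite mulr0 subr0.
by case: (x n) => a b /=; rewrite mulr0 add0r.
Qed.

Lemma measurable_cmod_rademacher_sum (R : realType) N (x : 'I_N -> R[i]) :
  measurable_fun setT (fun t : measurableTypeR R => cmod (rademacher_sum x t)).
Proof.
under eq_fun do rewrite rademacher_sumE /=.
apply: (@measurableT_comp _ _ _ _ _ _ (@Num.sqrt R)).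
  by apply: nondecreasing_measurable => // a b; exact: ler_wsqrtr.
by apply: measurable_funD; apply: measurable_funX; exact: measurable_rademacher_comb.
Qed.

Lemma integral_cmod_rademacher_sum_sqr (R : realType) N (x : 'I_N -> R[i]) :
  (\int[lebesgue01 R]_t (cmod (rademacher_sum x t) ^+ 2)%:E =
   (\sum_(n < N) cmod (x n) ^+ 2)%:E)%E.
Proof.
under eq_integral do rewrite cmod_sqr rademacher_sumE /= EFinD.
have m (a : 'I_N -> R) : measurable_fun setT
    (fun t : measurableTypeR R => (rademacher_comb 1 a t ^+ 2)%:E).
  by apply/measurable_EFinP/measurable_funX; exact: measurable_rademacher_comb.
rewrite ge0_integralD//; try by move=> t _; rewrite lee_fin sqr_ge0.
rewrite !integral_rademacher_comb_sqr -EFinD -big_split/=.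
by congr EFin; apply: eq_bigr => n _; rewrite cmod_sqr.
Qed.

Lemma L2norm_rademacher_sum (R : realType) N (x : 'I_N -> R[i]) :
  L2norm (lebesgue01 R) (rademacher_sum x) =
  (Num.sqrt (\sum_(n < N) cmod (x n) ^+ 2))%:E.
Proof.
rewrite /L2norm unlock.
under eq_integral => t _.
  rewrite abse_EFin (ger0_norm (cmod_ge0 _ _)) poweR_EFin powR_mulrn ?cmod_ge0//.
  over.
rewrite integral_cmod_rademacher_sum_sqr poweR_EFin powR12_sqrt//.
by apply: sumr_ge0 => n _; exact: sqr_ge0.
Qed.

(** [|u| + |v|] is at most twice the larger of the two, and [expR (2 * |w|)] is one of the two
    exponentials of [w] on the right. *)
Lemma expR_normD_le (R : realType) (u v : R) :
  expR (`|u| + `|v|) <=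
  expR (2 * u) + expR (- 2 * u) + (expR (2 * v) + expR (- 2 * v)).
Proof.
have le_abs (w : R) : expR (2 * `|w|) <= expR (2 * w) + expR (- 2 * w).
  have [w0|w0] := ger0P w; first by rewrite lerDl expR_ge0.
  by rewrite mulrN mulNr lerDr expR_ge0.
have := le_abs u; have := le_abs v.
have eu := expR_ge0 (2 * `|u|); have ev := expR_ge0 (2 * `|v|).
have [uv|uv] := leP `|u| `|v|.
  have : expR (`|u| + `|v|) <= expR (2 * `|v|) by rewrite ler_expR; lra.
  lra.
have : expR (`|u| + `|v|) <= expR (2 * `|u|) by rewrite ler_expR; lra.
lra.
Qed.

(** The modulus is at most [|Re| + |Im|], which leaves four real exponential moments. Each has
    coefficients [2 * y n / s] up to sign, with squares summing to at most 4, so the sub-Gaussian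
    bound gives [expR 8]. *)
Lemma integral_expR_cmod_rademacher_sum (R : realType) N (x : 'I_N -> R[i]) (s : R) :
  0 < s -> \sum_(n < N) cmod (x n) ^+ 2 <= s ^+ 2 ->
  (\int[lebesgue01 R]_t (expR (cmod (rademacher_sum x t) / s))%:E
   <= (4 * expR 8)%:E)%E.
Proof.
move=> s0 xs.
have s20 : 0 < s ^+ 2 by rewrite exprn_gt0.
pose a n := complex.Re (x n); pose b n := complex.Im (x n).
pose F (c : R) (y : 'I_N -> R) (t : R) :=
  expR (rademacher_comb 1 (fun n => c / s * y n) t).
have FE c y t : F c y t = expR (c * (rademacher_comb 1 y t / s)).
  rewrite /F /rademacher_comb mulrA mulrAC mulr_sumr; congr expR.
  by apply: eq_bigr => n _; rewrite mulrA.
have mF c y : measurable_fun setT (fun t : measurableTypeR R => (F c y t)%:E).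
  by apply/measurable_EFinP/measurableT_comp => //; exact: measurable_rademacher_comb.
have F0 c y t : (0 <= (F c y t)%:E)%E by rewrite lee_fin expR_ge0.
have intF c y : c ^+ 2 = 4 -> (forall n, y n ^+ 2 <= cmod (x n) ^+ 2) ->
    (\int[lebesgue01 R]_t (F c y t)%:E <= (expR 8)%:E)%E.
  move=> c4 yx; apply: (le_trans (integral_expR_rademacher_comb _ _ _ _)).
  rewrite lee_fin ler_expR.
  under eq_bigr do rewrite exprMn expr_div_n c4.
  rewrite -mulr_sumr.
  have : \sum_(n < N) y n ^+ 2 <= s ^+ 2.
    by apply: le_trans xs; apply: ler_sum => n _; exact: yx.
  rewrite -[leRHS]mulr1 -(ler_pdivrMl _ _ s20) => h.
  have -> : 2 * (4 / s ^+ 2 * \sum_(i < N) y i ^+ 2) =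
    8 * ((s ^+ 2)^-1 * \sum_(i < N) y i ^+ 2) by ring.
  lra.
have ax n : a n ^+ 2 <= cmod (x n) ^+ 2 by rewrite cmod_sqr lerDl sqr_ge0.
have bx n : b n ^+ 2 <= cmod (x n) ^+ 2 by rewrite cmod_sqr lerDr sqr_ge0.
apply: (@le_trans _ _ (\int[lebesgue01 R]_t
  (((F 2 a t)%:E + (F (-2) a t)%:E) + ((F 2 b t)%:E + (F (-2) b t)%:E)))%E).
  apply: ge0_le_integral => //.
  - apply/measurable_EFinP; apply: measurableT_comp => //.
    apply: measurable_funM => //; exact: measurable_cmod_rademacher_sum.
  - by do 2 apply: emeasurable_funD => //.
  - move=> t _; rewrite -!EFinD lee_fin !FE.
    apply: le_trans (expR_normD_le _ _ _).
    rewrite ler_expR !normrM (gtr0_norm (_ : 0 < s^-1)) ?invr_gt0//.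
    rewrite -mulrDl ler_pM2r ?invr_gt0//.
    by apply: (le_trans (cmod_le _ _)); rewrite rademacher_sumE.
have mD c1 c2 y1 y2 : measurable_fun setT
    (fun t : measurableTypeR R => ((F c1 y1 t)%:E + (F c2 y2 t)%:E)%E).
  exact: emeasurable_funD.
have D0 c1 c2 y1 y2 t : (0 <= (F c1 y1 t)%:E + (F c2 y2 t)%:E)%E by exact: adde_ge0.
rewrite !ge0_integralD//.
have -> : 4 * expR 8 = (expR 8 + expR 8) + (expR 8 + expR 8) :> R by ring.
by rewrite !EFinD; apply: leeD; apply: leeD; apply: intF => //; ring.
Qed.

(** * The comparison of the Luxemburg and L2 norms *)

Theorem lemma3p1 (R : realType) (psi : R -> R)
    (psi_young : young_function psi)
    (psi_growth : exists C x0 : R, [/\ 0 < C, 0 <= x0 &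
       forall x, x0 <= x -> x <= C * psi x /\ psi x <= C * expR x]) :
  exists c_psi C_psi : R, [/\ 0 < c_psi, 0 < C_psi &
    forall (N : nat) (x : 'I_N -> R[i]), (1 <= N)%N ->
    [/\ (c_psi%:E * L2norm (lebesgue01 R) (rademacher_sum x)
           <= luxemburg_norm (lebesgue01 R) psi (rademacher_sum x))%E,
        (luxemburg_norm (lebesgue01 R) psi (rademacher_sum x)
           <= C_psi%:E * L2norm (lebesgue01 R) (rademacher_sum x))%E &
        L2norm (lebesgue01 R) (rademacher_sum x)
          = (Num.sqrt (\sum_(n < N) cmod (x n) ^+ 2))%:E]].
Proof.
have [C [x0 [C0 x00 psiC]]] := psi_growth.
(* [D] is absolute, so [K] and [B] depend only on [C] and [x0], which come from [psi] alone. *)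
pose D : R := 4 * expR 8.
have D0 : 0 < D by rewrite mulr_gt0// expR_gt0.
pose K := 2 * (1 + 48 * D) * (x0 + C).
have K0 : 0 < K.
  by rewrite /K !mulr_gt0//; [rewrite addr_gt0// mulr_gt0|rewrite ltr_wpDl].
pose B := 1 + C * expR x0 * D.
have B0 : 0 < B by rewrite addr_gt0// !mulr_gt0// expR_gt0.
exists K^-1, B; split => //; first by rewrite invr_gt0.
move=> N x _; rewrite L2norm_rademacher_sum.
set S := \sum_(n < N) _; set s := Num.sqrt S.
have S0 : 0 <= S by apply: sumr_ge0 => n _; exact: sqr_ge0.
have s0 : 0 <= s by exact: sqrtr_ge0.
have sS : s ^+ 2 = S by rewrite sqr_sqrtr.
have mf := measurable_cmod_rademacher_sum R N x.
split => //.
(* For [s = 0] normalization by [s] is impossible, but the lower bound is then 0 and all admissible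
   parameters are positive. *)
- have [->|sn0] := eqVneq s 0.
    rewrite mule0; apply: le_ereal_inf_tmp => _ /= [l [l0 _] <-].
    by rewrite lee_fin ltW.
  have sp : 0 < s by rewrite lt_neqAle eq_sym sn0.
  rewrite -EFinM mulrC.
  apply: (luxemburg_norm_ge_second_moment _ _ _ _ psi C x0 psi_young C0 x00 _ s D) => //.
  + by move=> u /psiC[].
  + by apply: integral_expR_cmod_rademacher_sum => //; rewrite sS.
  + under eq_integral do rewrite expr_div_n mulrC EFinM.
    rewrite ge0_integralZl_EFin//.
    * by rewrite integral_cmod_rademacher_sum_sqr -EFinM sS mulVf// -sS expf_neq0.
    * by move=> t _; rewrite lee_fin sqr_ge0.
    * by apply/measurable_EFinP; exact: measurable_funX.
    * by rewrite invr_ge0 sqr_ge0.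
(* The slack [e] replaces the scale [s] by [s + e / B], which is positive even when [s = 0]. *)
- apply/lee_addgt0Pr => e e0.
  have se : 0 < s + e / B by rewrite ltr_wpDl// divr_gt0.
  rewrite -EFinM -EFinD (_ : B * s + e = B * (s + e / B)); last first.
    by field; rewrite gt_eqF.
  apply: luxemburg_norm_le_exp_moment => //.
  + by move=> u /psiC[].
  + apply: integral_expR_cmod_rademacher_sum => //; rewrite -/S -sS.
    by rewrite lerXn2r// ?nnegrE ?(ltW se)// lerDl divr_ge0// ltW.
Qed.
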